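(* Let $G_n=\overline{C_n}$ for $n\ge 3$ be the graph complement of the cycle graph with $n$ vertices, let $G_2$ be the graph with two vertices and no edges, and let $G_n^+=\overline{L_n}$ be the graph complement of the path graph $L_n$ with $n$ vertices. Then for all $n\ge 2$, $$\chi(G_n)=1-2\cos(\pi n/3),\qquad \chi(G_n^+)=1-\cos(\pi n/3)+\frac{\sin(\pi n/3)}{\sqrt{3}}.$$
   Context: All graphs are finite and simple. The Euler characteristic of a graph $G$ is $\chi(G)=\sum_{k\ge 0}(-1)^k f_k(G)$, where $f_k(G)$ is the number of complete subgraphs $K_{k+1}$ in $G$. *)

(* Defs.v *)
From HB Require Import structures.
From mathcomp Require Import all_boot all_order all_algebra.
Set Implicit Arguments.
Unset Strict Implicit.
Unset Printing Implicit Defensive.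
Import Order.TTheory GRing.Theory Num.Theory.
Local Open Scope ring_scope.

Record sgraph := SGraph {
  vertex : finType;
  adj : rel vertex;
  adj_sym : symmetric adj;
  adj_irr : irreflexive adj
}.

Section EulerCharacteristic.
Variable G : sgraph.

(* A complete subgraph is determined by its vertex set, so K_m-subgraphs are
   counted as m-element sets of pairwise adjacent vertices. *)
Definition is_clique (A : {set vertex G}) : bool :=
  [forall x in A, forall y in A, (x != y) ==> adj x y].

Definition num_cliques (k : nat) : nat :=
  #|[set A : {set vertex G} | is_clique A & #|A| == k.+1]|.

(* The sum over all k >= 0 may stop at the number of vertices, by
   num_cliques_eq0 below. *)
Definition euler_char : int :=
  \sum_(k < #|vertex G|) (-1) ^+ k * (num_cliques k)%:Z.

Lemma num_cliques_eq0 k : (#|vertex G| <= k)%N -> num_cliques k = 0%N.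
Proof.
move=> le_k; apply/eqP; rewrite cards_eq0; apply/eqP/setP=> A.
rewrite !inE; apply/negbTE/negP=> /andP[_ /eqP cA].
by have := max_card (mem A); rewrite cA ltnNge le_k.
Qed.

End EulerCharacteristic.

Section Complement.
Variable G : sgraph.

Definition compl_adj : rel (vertex G) := fun x y => (x != y) && ~~ adj x y.

Fact compl_adj_sym : symmetric compl_adj.
Proof. by move=> x y; rewrite /compl_adj eq_sym adj_sym. Qed.

Fact compl_adj_irr : irreflexive compl_adj.
Proof. by move=> x; rewrite /compl_adj eqxx. Qed.

Definition compl_graph : sgraph := SGraph compl_adj_sym compl_adj_irr.

End Complement.

Section Families.
Variable n : nat.

Fact edgeless_adj_sym : symmetric (fun _ _ : 'I_n => false).
Proof. by []. Qed.

Fact edgeless_adj_irr : irreflexive (fun _ _ : 'I_n => false).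
Proof. by []. Qed.

Definition edgeless_graph : sgraph := SGraph edgeless_adj_sym edgeless_adj_irr.

(* ordS is the successor modulo n.  The conjunct i != j only matters for
   n = 1; this is the cycle C_n as soon as n >= 3. *)
Definition cycle_adj : rel 'I_n :=
  fun i j => (i != j) && ((j == ordS i) || (i == ordS j)).

Fact cycle_adj_sym : symmetric cycle_adj.
Proof. by move=> i j; rewrite /cycle_adj eq_sym orbC. Qed.

Fact cycle_adj_irr : irreflexive cycle_adj.
Proof. by move=> i; rewrite /cycle_adj eqxx. Qed.

Definition cycle_graph : sgraph := SGraph cycle_adj_sym cycle_adj_irr.

Definition path_adj : rel 'I_n :=
  fun i j => (val j == (val i).+1) || (val i == (val j).+1).

Fact path_adj_sym : symmetric path_adj.
Proof. by move=> i j; rewrite /path_adj orbC. Qed.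

Fact path_adj_irr : irreflexive path_adj.
Proof. by move=> i; rewrite /path_adj orbb -[X in X == _]addn0 -addn1 eqn_add2l. Qed.

Definition path_graph : sgraph := SGraph path_adj_sym path_adj_irr.

End Families.

(* Meant for n >= 2 only. *)
Definition anti_cycle (n : nat) : sgraph :=
  if n == 2%N then edgeless_graph 2 else compl_graph (cycle_graph n).

Definition anti_path (n : nat) : sgraph := compl_graph (path_graph n).

(* Main.v *)
Require Import Defs.
From mathcomp Require Import all_boot all_order all_algebra.
From mathcomp Require Import reals trigo.
From mathcomp Require Import zify ring lra.
Import Order.TTheory GRing.Theory Num.Theory.
Local Open Scope ring_scope.

(** Write [X(S)] for the sum of [(-1)^|A|] over all cliques [A], the empty one
    included, contained in the vertex set [S].  Grouping cliques by size gives
    [euler_char G = 1 - X(V)] ([euler_char_clique_sum]), so it suffices to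
    evaluate [X].  The advantage of [X] over the Euler characteristic is a
    recurrence: for [v] in [S], the cliques containing [v] are the sets
    [v |: A] with [A] a clique among the neighbours of [v], whence
    [X(S) = X(S - v) - X(S & N(v))] ([clique_sum_rec]).

    In the complement of a path, take for [S] an interval and for [v] its last
    vertex: both [S - v] and [S & N(v)] are again intervals, shorter by one and
    by two.  So the value [p_m] of [X] on an interval of length [m] satisfies
    [p_(m+2) = p_(m+1) - p_m], with [p_0 = 1] and [p_1 = 0].  The characteristic
    roots are the primitive sixth roots of unity, so the solution is
    [p_m = cos (pi m / 3) - sin (pi m / 3) / sqrt 3] ([clique_sum_interval]),
    which is the formula for the complement of the path.

    In the complement of the cycle with [n >= 3] vertices, removing one vertex
    leaves an interval of length [n - 1], and its neighbours form an interval of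
    length [n - 3] ([clique_sum_anti_cycle]); away from the removed vertex,
    cycle and path adjacency agree.  Hence
    [X(V) = p_(n-1) - p_(n-3) = 2 cos (pi n / 3)]. *)

Definition clique_sum {G : sgraph} (S : {set vertex G}) : int :=
  \sum_(A : {set vertex G} | is_clique A && (A \subset S)) (-1) ^+ #|A|.

Lemma is_cliqueP {G : sgraph} (A : {set vertex G}) :
  reflect {in A &, forall x y, x != y -> adj x y} (is_clique A).
Proof.
apply: (iffP idP) => [/forall_inP cA x y xA yA | cA].
  exact/implyP/(forall_inP (cA x xA)).
by apply/forall_inP=> x xA; apply/forall_inP=> y yA; apply/implyP/cA.
Qed.

Lemma is_cliqueU1 {G : sgraph} (v : vertex G) (A : {set vertex G}) :
  v \notin A ->
  is_clique (v |: A) = is_clique A && (A \subset [set u | adj v u]).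
Proof.
move=> vA; apply/is_cliqueP/andP => [cvA | [/is_cliqueP cA /subsetP Av] x y].
  split; first by apply/is_cliqueP=> x y xA yA; apply: cvA; rewrite setU1r.
  apply/subsetP=> x xA; rewrite inE cvA ?setU11 ?setU1r //.
  by apply: contraNneq vA => ->.
rewrite !inE => /orP[/eqP-> | xA] /orP[/eqP-> | yA]; first by rewrite eqxx.
- by move/Av: yA; rewrite inE.
- by move/Av: xA; rewrite inE adj_sym.
exact: cA.
Qed.

Lemma clique_sum_set0 {G : sgraph} : clique_sum (set0 : {set vertex G}) = 1.
Proof.
rewrite /clique_sum (big_pred1 (@set0 (vertex G))) ?cards0 // => A.
rewrite /= subset0 andbC; case: eqP => [->|] //=.
by apply/is_cliqueP=> x y; rewrite inE.
Qed.

(** Deleting [v]: the cliques through [v] correspond to the cliques in its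
    neighbourhood, with one vertex less and therefore the opposite sign. *)
Lemma clique_sum_rec {G : sgraph} (v : vertex G) (S : {set vertex G}) :
  v \in S ->
  clique_sum S = clique_sum (S :\ v) - clique_sum (S :&: [set u | adj v u]).
Proof.
move=> vS; rewrite /clique_sum (bigID (fun A : {set vertex G} => v \notin A)) /=.
congr (_ + _); first by apply: eq_bigl => A; rewrite subsetD1 andbA.
(* The cliques through v are reindexed by A |-> v |: A; the condition
   (v |: A) :\ v = A of the reindexing restricts it to the A avoiding v. *)
rewrite (reindex_onto (setU [set v]) (fun A => A :\ v)) /=; last first.
  by move=> A /andP[_ /negPn vA]; rewrite setD1K.
rewrite -sumrN; apply: eq_big => [A | A].
  case vA: (v \in A).
    rewrite (_ : _ == A = false) ?andbF /=; last first.
      by apply/eqP=> /setP/(_ v); rewrite !inE eqxx vA.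
    rewrite subsetI; case: (boolP (A \subset [set u | _])) => [/subsetP/(_ v vA)|_].
      by rewrite inE adj_irr.
    by rewrite !andbF.
  rewrite setU1K ?vA // eqxx setU11 /= !andbT is_cliqueU1 ?vA //.
  by rewrite subUset sub1set vS subsetI /= -andbA [X in _ && X]andbC.
rewrite setU11 /= andbT => /andP[_ /eqP/setP/(_ v)].
by rewrite !inE eqxx /= => vA; rewrite cardsU1 -vA exprS mulN1r.
Qed.

(** The Euler characteristic omits the empty clique and gives a [k.+1]-element
    clique the sign [(-1)^k], hence the [1] and the minus sign. *)
Lemma euler_char_clique_sum (G : sgraph) :
  euler_char G = 1 - clique_sum [set: vertex G].
Proof.
rewrite /clique_sum (partition_big
  (fun A : {set vertex G} => inord #|A| : 'I_#|vertex G|.+1) xpredT) //=.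
rewrite (eq_bigr (fun k : 'I_#|vertex G|.+1 => (-1) ^+ k *
  (#|[set A : {set vertex G} | is_clique A & #|A| == k]|)%:Z)); last first.
  move=> k _; rewrite -natz mulr_natr -sumr_const; apply: eq_big => A.
    by rewrite inE subsetT andbT -val_eqE /= inordK // ltnS max_card.
  by rewrite -val_eqE /= inordK ?ltnS ?max_card // => /andP[_ /eqP->].
rewrite big_ord_recl expr0 mul1r (_ : #|_| = 1%N); last first.
  rewrite -(cards1 (set0 : {set vertex G})); congr #|pred_of_set _|.
  apply/setP=> A; rewrite !inE cards_eq0 andbC; case: eqP => [->|] //=.
  by apply/is_cliqueP=> x y; rewrite inE.
rewrite opprD addNKr -sumrN /euler_char; apply: eq_bigr => k _.
by rewrite lift0 exprS -mulrA mulN1r opprK.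
Qed.

Definition ord_interval (n a m : nat) : {set 'I_n} :=
  [set i : 'I_n | (a <= i < a + m)%N].

Lemma compl_path_adjE (n : nat) (i j : 'I_n) :
  @compl_adj (path_graph n) i j =
  [&& val i != val j, val j != (val i).+1 & val i != (val j).+1].
Proof. by rewrite /compl_adj /= /path_adj negb_or. Qed.

(** The last vertex of an interval is non-adjacent, in the complement of the
    path, only to itself and its predecessor.  The graph is required to look
    like the complement of a path on the interval only, so that the recurrence
    also serves in the complement of a cycle.  The truncated [m.-1] is right
    for [m = 0]: the neighbourhood inside a one-vertex interval is empty. *)
Lemma clique_sum_interval_rec (n : nat) (e : rel 'I_n)
    (es : symmetric e) (ei : irreflexive e) (a m : nat) :
  (a + m.+1 <= n)%N ->
  {in ord_interval n a m.+1 &, e =2 @compl_adj (path_graph n)} ->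
  let X k := @clique_sum (SGraph es ei) (ord_interval n a k) in
  X m.+1 = X m - X m.-1.
Proof.
move=> le_n eE X; have lt_n : (a + m < n)%N by lia.
have lastP : Ordinal lt_n \in ord_interval n a m.+1 by rewrite inE /=; lia.
rewrite /X (@clique_sum_rec (SGraph es ei) (Ordinal lt_n)) //.
congr (@clique_sum (SGraph es ei) _ - @clique_sum (SGraph es ei) _);
  apply/setP => i.
  by rewrite !inE -val_eqE /=; lia.
rewrite !inE /=; case: (boolP (a <= i < a + m.+1)%N) => iP /=; last by lia.
have iS : i \in ord_interval n a m.+1 by rewrite inE.
rewrite (eE _ _ lastP iS) compl_path_adjE /=; lia.
Qed.

(** The triple-angle formula at [pi = 3 (pi / 3)] says that [c = cos (pi / 3)]
    is a root of [4 c^3 - 3 c + 1 = (c + 1) (2 c - 1)^2], and it is positive. *)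
Lemma cos_pi_div3 (R : realType) : cos (pi / 3 : R) = 1 / 2.
Proof.
have pi_gt0 := pi_gt0 R.
have c_gt0 : 0 < cos (pi / 3 : R) by apply: cos_gt0_pihalf; lra.
have : cos (pi / 3 + pi / 3 + pi / 3 : R) = -1.
  by rewrite -cospi; congr cos; field.
rewrite !(cosD, sinD); have := cos2Dsin2 (pi / 3 : R).
move: (cos _) (sin _) c_gt0 => c s c_gt0 s2 c3.
have cs2 : c * s ^+ 2 = c - c ^+ 3 by rewrite exprS -[X in X - _]mulr1 -s2; ring.
have : (c + 1) * (2 * c - 1) ^+ 2 = 0 by lra.
move/eqP; rewrite mulf_eq0 sqrf_eq0 => /orP[] /eqP c_val; lra.
Qed.

Lemma sin_pi_div3 (R : realType) : sin (pi / 3 : R) = Num.sqrt 3 / 2.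
Proof.
have pi_gt0 := pi_gt0 R.
have s_gt0 : 0 < sin (pi / 3 : R) by apply: sin_gt0_pi; lra.
have := cos2Dsin2 (pi / 3 : R); rewrite cos_pi_div3 => s2.
have sqr_s : (2 * sin (pi / 3)) ^+ 2 = 3 :> R by lra.
by rewrite -[in Num.sqrt _]sqr_s sqrtr_sqr gtr0_norm; lra.
Qed.

(** These two sequences give the rotation by a sixth of a turn.  Scaling the
    sine by [1 / sqrt 3] makes its matrix rational, so that identities between
    values at different [n] become linear identities over the rationals. *)
Definition turn_cos (R : realType) (n : nat) : R := cos (pi * n%:R / 3).
Definition turn_sin (R : realType) (n : nat) : R := sin (pi * n%:R / 3) / Num.sqrt 3.

Lemma turn_cosS (R : realType) (n : nat) :
  turn_cos R n.+1 = turn_cos R n / 2 - turn_sin R n * (3 / 2).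
Proof.
have r2 : Num.sqrt 3 * Num.sqrt 3 = 3 :> R by rewrite -expr2 sqr_sqrtr ?ler0n.
have r0 : Num.sqrt 3 != 0 :> R by rewrite gt_eqF ?sqrtr_gt0 ?ltr0n.
rewrite /turn_cos /turn_sin -natr1 mulrDr mulr1 mulrDl cosD.
rewrite cos_pi_div3 sin_pi_div3.
by move: (cos _) (sin _) (Num.sqrt 3) r2 r0 => c s r <- r0; field.
Qed.

Lemma turn_sinS (R : realType) (n : nat) :
  turn_sin R n.+1 = (turn_sin R n + turn_cos R n) / 2.
Proof.
have r0 : Num.sqrt 3 != 0 :> R by rewrite gt_eqF ?sqrtr_gt0 ?ltr0n.
rewrite /turn_cos /turn_sin -natr1 mulrDr mulr1 mulrDl sinD.
rewrite cos_pi_div3 sin_pi_div3; by field.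
Qed.

Lemma turn_cos0 (R : realType) : turn_cos R 0 = 1.
Proof. by rewrite /turn_cos mulr0 mul0r cos0. Qed.

Lemma turn_sin0 (R : realType) : turn_sin R 0 = 0.
Proof. by rewrite /turn_sin mulr0 mul0r sin0 mul0r. Qed.

(** Both sides satisfy [p_(m+2) = p_(m+1) - p_m] with the same initial values. *)
Lemma clique_sum_interval (R : realType) (n : nat) (e : rel 'I_n)
    (es : symmetric e) (ei : irreflexive e) (a m : nat) :
  (a + m <= n)%N ->
  {in ord_interval n a m &, e =2 @compl_adj (path_graph n)} ->
  (@clique_sum (SGraph es ei) (ord_interval n a m))%:~R =
    turn_cos R m - turn_sin R m.
Proof.
have [k] := ubnP m; elim: k m => // k IHk [|m] lt_k le_n eE.
  rewrite (_ : ord_interval n a 0 = set0).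
    by rewrite (@clique_sum_set0 (SGraph es ei)) turn_cos0 turn_sin0 subr0.
  by apply/setP=> i; rewrite !inE; lia.
have IH j : (j <= m)%N -> (@clique_sum (SGraph es ei) (ord_interval n a j))%:~R =
    turn_cos R j - turn_sin R j.
  move=> le_j; apply: IHk; [lia | lia | move=> x y xP yP].
  by apply: eE; [move: xP | move: yP]; rewrite !inE; lia.
rewrite clique_sum_interval_rec // rmorphB /= !IH; [|lia|lia].
rewrite turn_cosS turn_sinS; case: {IH lt_k le_n eE} m => [|m] /=.
  (* Here m.-1 = m, so the recurrence reads p_1 = p_0 - p_0 = 0. *)
  by rewrite turn_cos0 turn_sin0; field.
by rewrite turn_cosS turn_sinS; field.
Qed.

Lemma val_ordS_case (n : nat) (i : 'I_n) :
  val (ordS i) = (if i.+1 == n then 0 else i.+1)%N.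
Proof.
rewrite /=; case: eqP => [->|i_n]; first by rewrite modnn.
by rewrite modn_small // ltn_neqAle ltn_ord andbT; apply/eqP.
Qed.

Lemma compl_cycle_adjE (n : nat) (i j : 'I_n) :
  @compl_adj (cycle_graph n) i j =
  [&& val i != val j, val j != val (ordS i) & val i != val (ordS j)].
Proof.
by rewrite /compl_adj /= /cycle_adj negb_and negb_or andb_orr andbN /=.
Qed.

(** The cycle differs from the path only by the edge from [n - 1] to [0]. *)
Lemma compl_cycle_path_adj (n : nat) (i j : 'I_n) :
  (0 < i)%N -> (0 < j)%N ->
  @compl_adj (cycle_graph n) i j = @compl_adj (path_graph n) i j.
Proof.
move=> i_gt0 j_gt0; rewrite compl_cycle_adjE compl_path_adjE !val_ordS_case /=.
have := ltn_ord i; have := ltn_ord j.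
by case: (i.+1 =P n); case: (j.+1 =P n); lia.
Qed.

(** Deleting vertex [0]: what remains is [1, ..., n - 1], and its neighbours in
    the complement are [2, ..., n - 2], for [n = m.+3]. *)
Lemma clique_sum_anti_cycle (m : nat) :
  let G := compl_graph (cycle_graph m.+3) in
  @clique_sum G setT =
  @clique_sum G (ord_interval m.+3 1 m.+2) - @clique_sum G (ord_interval m.+3 2 m).
Proof.
move=> G; rewrite (@clique_sum_rec G ord0) ?inE //.
congr (@clique_sum G _ - @clique_sum G _); apply/setP => i;
  rewrite !inE /= -?val_eqE; have := ltn_ord i; first by move=> /=; lia.
by rewrite compl_cycle_adjE !val_ordS_case /=; case: (i.+1 =P m.+3); lia.
Qed.

Lemma ord_interval_setT (n : nat) : ord_interval n 0 n = setT.
Proof. by apply/setP=> i; rewrite !inE add0n ltn_ord. Qed.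

Theorem corollary1 (R : realType) (n : nat) (hn : (2 <= n)%N) :
  (euler_char (anti_cycle n))%:~R = 1 - 2 * cos (pi * n%:R / 3) :> R /\
  (euler_char (anti_path n))%:~R =
    1 - cos (pi * n%:R / 3) + sin (pi * n%:R / 3) / Num.sqrt 3 :> R.
Proof.
rewrite -/(turn_cos R n) -/(turn_sin R n) !euler_char_clique_sum !rmorphB /=.
split; last first.
  rewrite -[X in clique_sum X]ord_interval_setT clique_sum_interval //.
  by rewrite opprB addrA addrAC.
congr (_ - _); case: n hn => [|[|[|m]]] // _.
  (* Two isolated vertices also form the complement of the path with n = 2. *)
  rewrite -[X in clique_sum X]ord_interval_setT clique_sum_interval //; last first.
    by move=> i j _ _; case: i => [[|[|i]] ?]; case: j => [[|[|j]] ?].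
  by rewrite !(turn_cosS, turn_sinS) turn_cos0 turn_sin0; field.
have e_path : {in ord_interval m.+3 1 m.+2 &,
    @compl_adj (cycle_graph m.+3) =2 @compl_adj (path_graph m.+3)}.
  move=> i j; rewrite !inE => /andP[i_gt0 _] /andP[j_gt0 _].
  exact: compl_cycle_path_adj.
rewrite [X in X%:~R]clique_sum_anti_cycle rmorphB /= !clique_sum_interval //.
  by rewrite !(turn_cosS, turn_sinS); field.
move=> i j iP jP; apply: e_path; [move: iP | move: jP]; rewrite !inE; lia.
Qed.
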